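(* Let $\mathcal X,\mathcal Y$ be Hilbert spaces and let $(C,\mathbf A)$, with $C\in\mathcal L(\mathcal X,\mathcal Y)$ and $\mathbf A=(A_1,\dots,A_d)\in\mathcal L(\mathcal X)^d$, be a contractive pair. Then there exist a Hilbert space $\mathcal U$ and a function $S\in\mathcal S_d(\mathcal U,\mathcal Y)$ such that $$K_S(\lambda,\zeta)=K_{C,\mathbf A}(\lambda,\zeta)\qquad\text{for all }\lambda,\zeta\in\mathbb B^d .$$
   Context: $\mathcal L(\cdot,\cdot)$ denotes bounded linear operators. $\mathbb B^d$ is the open unit ball of $\mathbb C^d$ with inner product $\langle\lambda,\zeta\rangle=\sum_j\lambda_j\overline{\zeta_j}$; $\mathcal H(k_d)$ is the reproducing kernel Hilbert space on $\mathbb B^d$ with kernel $k_d(\lambda,\zeta)=1/(1-\langle\lambda,\zeta\rangle)$ and $\mathcal H_{\mathcal Y}(k_d)=\mathcal H(k_d)\otimes\mathcal Y$, viewed as a space of $\mathcal Y$-valued functions. $\mathcal S_d(\mathcal U,\mathcal Y)$ is the set of $\mathcal L(\mathcal U,\mathcal Y)$-valued analytic functions $S$ on $\mathbb B^d$ such that $f\mapsto S f$ is a contraction from $\mathcal H_{\mathcal U}(k_d)$ into $\mathcal H_{\mathcal Y}(k_d)$. Put $K_S(\lambda,\zeta)=\dfrac{I_{\mathcal Y}-S(\lambda)S(\zeta)^*}{1-\langle\lambda,\zeta\rangle}$. The pair $(C,\mathbf A)$ is contractive if $A_1^*A_1+\cdots+A_d^*A_d+C^*C\le I_{\mathcal X}$.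 Put $$K_{C,\mathbf A}(\lambda,\zeta)=C(I-\lambda_1A_1-\cdots-\lambda_dA_d)^{-1}(I-\overline{\zeta_1}A_1^*-\cdots-\overline{\zeta_d}A_d^* )^{-1}C^* .$$ *)

(* Defs.v *)
From HB Require Import structures.
From mathcomp Require Import all_boot all_order all_algebra.
From mathcomp Require Import complex.
From mathcomp Require Import all_classical all_reals all_analysis.
Import Order.TTheory GRing.Theory Num.Theory.
Import numFieldNormedType.Exports.

Set Implicit Arguments.
Unset Strict Implicit.
Unset Printing Implicit Defensive.

Local Open Scope classical_set_scope.
Local Open Scope complex_scope.
Local Open Scope ring_scope.

(* Complex Hilbert spaces.  The norm of a normed module over R[i] takes its
   values in R[i] (in the nonnegative reals); [hdot] is linear in its first
   argument and conjugate-linear in the second. *)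
HB.mixin Record CompleteNormedModule_isHilbert (R : realType) V
    & CompleteNormedModule R[i] V := {
  hdot : {dot V for (@Num.conj R[i])};
  hdot_norm : forall x : V, hdot x x = `|x| ^+ 2
}.

#[short(type="hilbertType")]
HB.structure Definition Hilbert (R : realType) :=
  {V of CompleteNormedModule R[i] V & CompleteNormedModule_isHilbert R V}.

(* L(X, Y) *)
Record boundedOp (R : realType) (X Y : hilbertType R) := BoundedOp {
  boundedOp_linear :> {linear X -> Y};
  boundedOpP : exists M : R[i], forall x, `|boundedOp_linear x| <= M * `|x|
}.

(* T^* y is the vector z with <T x, y> = <x, z> for all x; it exists and is
   unique for bounded T by the Riesz representation theorem. *)
Definition adj (R : realType) (X Y : hilbertType R) (T : X -> Y) : Y -> X :=
  fun y => xget 0 [set z | forall x, hdot (T x) y = hdot x z].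

(* T^-1, for bijective T *)
Definition op_inv (R : realType) (X : hilbertType R) (T : X -> X) : X -> X :=
  fun y => xget 0 [set x | T x = y].

(* The Loewner order; recall that a <= b in R[i] forces b - a to be real. *)
Definition op_le (R : realType) (X : hilbertType R) (T1 T2 : X -> X) : Prop :=
  forall x, 0 <= hdot (T2 x - T1 x) x.

Definition cdot (R : realType) (d : nat) (u v : 'rV[R[i]]_d) : R[i] :=
  \sum_(j < d) u 0 j * Num.conj (v 0 j).

Definition cnorm (R : realType) (d : nat) (u : 'rV[R[i]]_d) : R[i] :=
  sqrtC (cdot u u).

Record uball (R : realType) (d : nat) := UBall {
  uball_pt :> 'rV[R[i]]_d;
  uball_lt1 : cnorm uball_pt < 1
}.

(* A Hilbert space of complex functions on Omega with reproducing kernel k.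
   An element f stands for the function fun l => rk_eval l f, and rk_ker z
   for k(., z).  Such a space exists for every positive kernel k and is unique
   up to a unitary map respecting the values of functions (Aronszajn). *)
Record rkhs (R : realType) (Omega : Type) (k : Omega -> Omega -> R[i]) := Rkhs {
  rk_space :> hilbertType R;
  rk_eval : Omega -> {scalar rk_space};
  rk_eval_inj : forall f g, (forall l, rk_eval l f = rk_eval l g) -> f = g;
  rk_ker : Omega -> rk_space;
  rk_ker_eval : forall l z, rk_eval l (rk_ker z) = k l z;
  rk_reproducing : forall f z, hdot f (rk_ker z) = rk_eval z f
}.

(* The Hilbert space tensor product of H and Y, viewed as a space of Y-valued
   functions: the elementary tensor of f and y is l |-> f(l) y, and this is
   extended by continuity.  It exists and is unique up to a unitary map
   respecting elementary tensors, hence values. *)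
Record rkhs_tensor (R : realType) (Omega : Type) (k : Omega -> Omega -> R[i])
    (H : rkhs k) (Y : hilbertType R) := RkhsTensor {
  rt_space :> hilbertType R;
  rt_tensor : {bilinear H -> Y -> rt_space};
  rt_tensor_dot : forall f g y z,
    hdot (rt_tensor f y) (rt_tensor g z) = hdot f g * hdot y z;
  rt_tensor_dense : dense
    [set F : rt_space | exists n (f : 'I_n -> H) (y : 'I_n -> Y),
       F = \sum_(i < n) rt_tensor (f i) (y i)];
  rt_eval : Omega -> boundedOp rt_space Y;
  rt_eval_tensor : forall l f y, rt_eval l (rt_tensor f y) = rk_eval H l f *: y;
  rt_eval_inj : forall F G, (forall l, rt_eval l F = rt_eval l G) -> F = G
}.

Definition k_DA (R : realType) (d : nat) (l z : uball R d) : R[i] :=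
  (1 - cdot l z)^-1.

(* Complex Frechet differentiability at every point of the ball, for the
   operator norm on L(U, Y); the D j are the partial derivatives at a. *)
Definition analytic (R : realType) (d : nat) (U Y : hilbertType R)
    (S : uball R d -> boundedOp U Y) : Prop :=
  forall a : uball R d, exists D : 'I_d -> boundedOp U Y,
  forall e : R[i], 0 < e -> exists2 r : R[i], 0 < r &
  forall z : uball R d, cnorm (uball_pt z - uball_pt a) < r -> forall u : U,
    `|S z u - S a u - \sum_(j < d) (uball_pt z 0 j - uball_pt a 0 j) *: D j u|
      <= e * cnorm (uball_pt z - uball_pt a) * `|u|.

Definition contractive_multiplier (R : realType) (d : nat) (U Y : hilbertType R)
    (S : uball R d -> boundedOp U Y) : Prop :=
  forall (H : rkhs (@k_DA R d)) (HU : rkhs_tensor H U) (HY : rkhs_tensor H Y)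
    (f : HU), exists2 g : HY,
      (forall l, rt_eval HY l g = S l (rt_eval HU l f)) & `|g| <= `|f|.

Definition schur_class (R : realType) (d : nat) (U Y : hilbertType R)
    (S : uball R d -> boundedOp U Y) : Prop :=
  analytic S /\ contractive_multiplier S.

Definition K_S (R : realType) (d : nat) (U Y : hilbertType R)
    (S : uball R d -> boundedOp U Y) (l z : uball R d) : Y -> Y :=
  fun y => (1 - cdot l z)^-1 *: (y - S l (adj (S z) y)).

Definition contractive_pair (R : realType) (d : nat) (X Y : hilbertType R)
    (C : boundedOp X Y) (A : 'I_d -> boundedOp X X) : Prop :=
  op_le (fun x => \sum_(j < d) adj (A j) (A j x) + adj C (C x)) idfun.

Definition K_CA (R : realType) (d : nat) (X Y : hilbertType R)
    (C : boundedOp X Y) (A : 'I_d -> boundedOp X X) (l z : uball R d) : Y -> Y :=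
  fun y =>
    C (op_inv (fun x => x - \sum_(j < d) uball_pt l 0 j *: A j x)
      (op_inv (fun x => x - \sum_(j < d) Num.conj (uball_pt z 0 j) *: adj (A j) x)
        (adj C y))).

(* Main.v *)
From HB Require Import structures.
Require Import Defs.
From mathcomp Require Import all_boot all_order all_algebra.
From mathcomp Require Import complex ring lra.
From mathcomp Require Import all_classical all_reals all_analysis.
Import Order.TTheory GRing.Theory Num.Theory.
Import numFieldNormedType.Exports.

Set Implicit Arguments.
Unset Strict Implicit.
Unset Printing Implicit Defensive.

Local Open Scope classical_set_scope.
Local Open Scope complex_scope.
Local Open Scope ring_scope.

(* Let V : X -> K = X^d (+) Y be the contraction x |-> (A_1 x, ..., A_d x, C x)
   and let Q be the positive square root of I - V V^*.  With
   G(l) (x_1, ..., x_d, y) = y + C (I - l A)^-1 (l_1 x_1 + ... + l_d x_d),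
   which satisfies G(l) V = C (I - l A)^-1, put U = K and S(l) = G(l) Q.  Then
   S(l) S(z)^* = G(l) G(z)^* - (G(l) V) (G(z) V)^*
               = I - (1 - <l, z>) C (I - l A)^-1 (I - z A)^-* C^*.
   So K_S(l, z) = W(l)^* W(z) with W(z) = (I - z A)^-* C^*, and this positivity
   makes S a contractive multiplier. *)

(** The role of Q: since V V^* + Q^2 = I, the map (x, k) |-> V x + Q k from X (+) K to K is a
    coisometry. If B and D are the X^d and Y components of Q, then S(l) = D + C (I - l A)^-1 (l B)
    is the transfer function of that colligation. Taking U to be all of K, instead of the closed
    range of Q, leaves S(l) S(z)^* unchanged. A sup bound on S over the ball does not control its
    multiplier norm when d > 1, so the bound has to come from the kernel identity. That identity
    speaks only about combinations of kernel vectors, which can be written in several ways. Hence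
    the Riesz lemma is stated for a relation between vectors and scalars with an arbitrary subspace
    as domain, and S f is obtained for each f as a representing vector. *)

Lemma le_of_sqr_le (R : realDomainType) (M a b : R) :
  0 <= M -> 0 <= a -> 0 <= b -> a ^+ 2 <= M * a * b -> a <= M * b.
Proof.
move=> M0; rewrite le_eqVlt => /predU1P[<- b0 _|a0 b0].
  by rewrite mulr_ge0.
by rewrite expr2 mulrAC ler_pM2r.
Qed.

(** * Real-valued norms *)

Section RealNorm.
Variable R : realType.

(* [`|x|] lives in [R[i]], whose order is only partial; [nrm x] is the same
   number in [R]. *)
Definition nrm (V : normedZmodType R[i]) (x : V) : R := complex.Re `|x|.

Lemma nrmE (V : normedZmodType R[i]) (x : V) : `|x| = (nrm x)%:C.
Proof. by rewrite RRe_real// normr_real. Qed.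

Lemma nrm_le (V : normedZmodType R[i]) (x : V) (r : R) :
  (`|x| <= r%:C) = (nrm x <= r).
Proof. by rewrite nrmE lecR. Qed.

Lemma nrm_lt (V : normedZmodType R[i]) (x : V) (r : R) :
  (`|x| < r%:C) = (nrm x < r).
Proof. by rewrite nrmE ltcR. Qed.

Lemma nrm_ge0 (V : normedZmodType R[i]) (x : V) : 0 <= nrm x.
Proof. by rewrite -lecR -nrmE normr_ge0. Qed.

Lemma nrm0 (V : normedZmodType R[i]) : nrm (0 : V) = 0.
Proof. by rewrite /nrm normr0. Qed.

Lemma nrm_eq0 (V : normedZmodType R[i]) (x : V) : nrm x = 0 -> x = 0.
Proof. by move=> x0; apply/eqP; rewrite -normr_eq0 nrmE x0. Qed.

Lemma nrmN (V : normedZmodType R[i]) (x : V) : nrm (- x) = nrm x.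
Proof. by rewrite /nrm normrN. Qed.

Lemma nrmD (V : normedZmodType R[i]) (x y : V) : nrm (x + y) <= nrm x + nrm y.
Proof. by rewrite -nrm_le rmorphD/= -!nrmE ler_normD. Qed.

Lemma nrmB (V : normedZmodType R[i]) (x y : V) : nrm (x - y) <= nrm x + nrm y.
Proof. by rewrite -(nrmN y) nrmD. Qed.

Lemma nrm_subC (V : normedZmodType R[i]) (x y : V) : nrm (x - y) = nrm (y - x).
Proof. by rewrite -nrmN opprB. Qed.

Lemma nrm_tri (V : normedZmodType R[i]) (z x y : V) :
  nrm (x - y) <= nrm (x - z) + nrm (z - y).
Proof. by rewrite -[x - y](subrKA z) nrmD. Qed.

Lemma nrmZ (V : normedModType R[i]) (c : R[i]) (x : V) :
  nrm (c *: x) = nrm c * nrm x.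
Proof. by apply: complexI; rewrite rmorphM/= -!nrmE normrZ. Qed.

Lemma nrmM (a b : R[i]) : nrm (a * b) = nrm a * nrm b.
Proof. by apply: complexI; rewrite rmorphM/= -!nrmE normrM. Qed.

Lemma nrmJ (a : R[i]) : nrm (Num.conj a) = nrm a.
Proof. by rewrite /nrm norm_conjC. Qed.

Lemma nrmR (r : R) : nrm r%:C = `|r|.
Proof. by rewrite /nrm normc_def/= expr0n addr0 sqrtr_sqr. Qed.

Lemma nrm_Re (a : R[i]) : complex.Re a <= nrm a.
Proof.
by apply: le_trans (ler_norm _) _; rewrite -lecR -nrmE normc_ge_Re.
Qed.

Lemma nrm_sqr (a : R[i]) : (nrm a ^+ 2)%:C = a * Num.conj a.
Proof. by rewrite rmorphXn/= -nrmE normCK. Qed.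

End RealNorm.

(** * Inner products: Cauchy-Schwarz and the induced norm *)

Section Dot.
Variable R : realType.
Variables (V : lmodType R[i]) (f : {dot V for (@Num.conj R[i])}).

Lemma dot_ge0 x : 0 <= f x x. Proof. exact: dnorm_ge0. Qed.

Lemma dotC x y : f x y = Num.conj (f y x).
Proof. by rewrite hermC/= expr0 mul1r. Qed.

Lemma dotZl a x y : f (a *: x) y = a * f x y.
Proof. by rewrite linearZl_LR. Qed.

Lemma dotZr a x y : f x (a *: y) = Num.conj a * f x y.
Proof. by rewrite linearZr_LR. Qed.

Lemma cauchy_schwarz x y : `|f x y| ^+ 2 <= f x x * f y y.
Proof.
have [->|y0] := eqVneq y 0.
  by rewrite (linear0r f) (linear0r f) normr0 expr0n mulr0.
have fy : 0 < f y y by exact: neq0_dnorm_gt0.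
have := dot_ge0 (f y y *: x - f x y *: y).
rewrite dnormB !dnormZ dotZl dotZr.
have yr : Num.conj (f y y) = f y y by rewrite -dotC.
rewrite (ger0_norm (ltW fy)) !rmorphM/= conjCK yr.
have -> : f y y * (Num.conj (f x y) * f x y) = f y y * `|f x y| ^+ 2.
  by rewrite normCK [Num.conj _ * _]mulrC.
have -> : f y y * (f x y * Num.conj (f x y)) = f y y * `|f x y| ^+ 2.
  by rewrite normCK.
have -> : f y y ^+ 2 * f x x + `|f x y| ^+ 2 * f y y -
  (f y y * `|f x y| ^+ 2 + f y y * `|f x y| ^+ 2) =
  f y y * (f x x * f y y - `|f x y| ^+ 2) by ring.
by rewrite pmulr_rge0// subr_ge0.
Qed.

(** Phrased for a bare form, with no norm on [V]: together with the next two lemmas it is what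
    installs the norm on [dsum]. *)
Lemma dot_sqrtD x y :
  sqrtC (f (x + y) (x + y)) <= sqrtC (f x x) + sqrtC (f y y).
Proof.
have nx := dot_ge0 x; have ny := dot_ge0 y.
rewrite -(@ler_pXn2r _ 2) ?nnegrE ?addr_ge0 ?sqrtC_ge0 ?dot_ge0//.
rewrite sqrrD !sqrtCK dnormD/= [leRHS]addrAC lerD2l.
rewrite (addcJ (f x y)) -[leRHS]mulr_natl ler_pM2l ?ltr0n//.
apply: le_trans (_ : `|f x y| <= _).
  apply: le_trans (normc_ge_Re _); rewrite lecR; exact: ler_norm.
rewrite -(@ler_pXn2r _ 2) ?nnegrE ?mulr_ge0 ?sqrtC_ge0// exprMn !sqrtCK.
exact: cauchy_schwarz.
Qed.

Lemma dot_sqrtZ a x : sqrtC (f (a *: x) (a *: x)) = `|a| * sqrtC (f x x).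
Proof. by rewrite dnormZ sqrtCM ?nnegrE ?exprn_ge0 ?dot_ge0// sqrCK. Qed.

Lemma dot_sqrt0_eq0 x : sqrtC (f x x) = 0 -> x = 0.
Proof. by move/eqP; rewrite sqrtC_eq0 dnorm_eq0 => /eqP. Qed.

End Dot.

(** * Convergence of sequences through real norms *)

Section Sequences.
Variable R : realType.

(** A positive element of [R[i]] is real, so every epsilon in [R[i]] can be traded for its real
    part. *)
Lemma cvg_nrmP (V : normedModType R[i]) (u : nat -> V) (l : V) :
  u @ \oo --> l <-> (fun n => nrm (u n - l)) @ \oo --> (0 : R).
Proof.
split=> /cvgrPdist_lt ul; apply/cvgrPdist_lt => e e0.
  have eC : 0 < e%:C by rewrite ltcR.
  near=> n; rewrite sub0r normrN ger0_norm ?nrm_ge0// nrm_subC -nrm_lt.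
  by near: n; exact: ul.
have eE : e = (complex.Re e)%:C by rewrite RRe_real// gtr0_real.
have e0' : 0 < complex.Re e by rewrite -ltcR -eE.
near=> n; rewrite eE nrm_lt nrm_subC -(ger0_norm (nrm_ge0 _)) -normrN -sub0r.
by near: n; exact: ul.
Unshelve. all: by end_near. Qed.

Lemma seq_cvg_unique (V : normedModType R[i]) (u : nat -> V) (l l' : V) :
  u @ \oo --> l -> u @ \oo --> l' -> l = l'.
Proof. exact: (cvg_unique (@norm_hausdorff _ V)). Qed.

Lemma cvg_lip (V W : normedModType R[i]) (f : V -> W) (M : R) (u : nat -> V) l :
  (forall x y, nrm (f x - f y) <= M * nrm (x - y)) ->
  u @ \oo --> l -> (f \o u) @ \oo --> f l.
Proof.
move=> fM /cvg_nrmP ul; apply/cvg_nrmP.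
apply: (@squeeze_cvgr _ _ _ _ (cst 0) (fun n => M * nrm (u n - l))).
- by near=> n; rewrite nrm_ge0 fM.
- exact: cvg_cst.
- by rewrite -(mulr0 M); apply: cvgMr.
Unshelve. all: by end_near. Qed.

Lemma cvg_nrm (V : normedModType R[i]) (u : nat -> V) l :
  u @ \oo --> l -> (fun n => nrm (u n)) @ \oo --> nrm l.
Proof.
move=> /cvg_nrmP ul; apply/cvgrPdist_lt => e e0.
move/cvgrPdist_lt: ul => /(_ _ e0) ul; near=> n.
have : `|0 - nrm (u n - l)| < e by near: n; exact: ul.
rewrite sub0r normrN ger0_norm ?nrm_ge0//; apply: le_lt_trans.
rewrite ler_norml; have := nrmD (u n - l) l; have := nrmB (u n) (u n - l).
rewrite subrK subKr; lra.
Unshelve. all: by end_near. Qed.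

Lemma cauchy_nrm_cvg (V : completeNormedModType R[i]) (u : nat -> V) :
  (forall e : R, 0 < e -> exists N, forall n, (N <= n)%N ->
    nrm (u n - u N) < e) ->
  exists l : V, u @ \oo --> l.
Proof.
move=> uC; apply/cvg_ex; apply: cauchy_cvg.
apply: cauchy_exP => e e0.
have eE : e = (complex.Re e)%:C by rewrite RRe_real// gtr0_real.
have [|N Nu] := uC (complex.Re e); first by rewrite -ltcR -eE.
exists (u N); exists N => // n /= Nn.
by rewrite -ball_normE /ball_/= eE nrm_lt nrm_subC Nu.
Qed.

Lemma telescope_nrm (V : normedModType R[i]) (u : nat -> V) (s : nat -> R) m n :
  (forall n, nrm (u n.+1 - u n) <= s n.+1 - s n) -> (m <= n)%N ->
  nrm (u n - u m) <= s n - s m.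
Proof.
move=> us /subnKC <-; elim: (n - m)%N => [|k IH].
  by rewrite addn0 !subrr nrm0.
rewrite addnS; apply: le_trans (nrm_tri (u (m + k)%N) _ _) _.
have := us (m + k)%N; lra.
Qed.

(** Majorant criterion: [s] is nondecreasing and bounded, hence convergent, which makes [u] Cauchy.
    It serves both the Neumann iteration and the square root iteration. *)
Lemma telescope_cvg (V : completeNormedModType R[i]) (u : nat -> V)
    (s : nat -> R) (B : R) :
  (forall n, nrm (u n.+1 - u n) <= s n.+1 - s n) -> (forall n, s n <= B) ->
  exists l : V, u @ \oo --> l.
Proof.
move=> us sB.
have snd : {homo s : m n / (m <= n)%N >-> m <= n}.
  move=> m n mn; rewrite -subr_ge0.
  exact: le_trans (nrm_ge0 _) (telescope_nrm us mn).
have sc : cvgn s.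
  by apply: nondecreasing_is_cvgn => //; exists B => _ [n _ <-].
apply: cauchy_nrm_cvg => e e0.
move/cvgrPdist_lt : (sc) => /(_ e e0) [N _ Nl].
exists N => n Nn; apply: le_lt_trans (telescope_nrm us Nn) _.
have := Nl _ (leqnn N); rewrite /= ltr_norml => /andP[_].
have : s n <= limn s by exact: nondecreasing_cvgn_le.
lra.
Qed.

End Sequences.

(** * Calculus of the Hilbert space inner product *)

Section Hdot.
Variables (R : realType) (H : hilbertType R).
Implicit Types (x y z : H) (a : R[i]).

Lemma hdotC x y : hdot x y = Num.conj (hdot y x).
Proof. exact: dotC. Qed.

Lemma hdotDl x y z : hdot (x + y) z = hdot x z + hdot y z.
Proof. exact: linearDl. Qed.

Lemma hdotDr x y z : hdot z (x + y) = hdot z x + hdot z y.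
Proof. exact: linearDr. Qed.

Lemma hdotBl x y z : hdot (x - y) z = hdot x z - hdot y z.
Proof. exact: linearBl. Qed.

Lemma hdotBr x y z : hdot z (x - y) = hdot z x - hdot z y.
Proof. exact: linearBr. Qed.

Lemma hdot0l z : hdot 0 z = 0.
Proof. exact: linear0l. Qed.

Lemma hdotZl a x z : hdot (a *: x) z = a * hdot x z.
Proof. exact: dotZl. Qed.

Lemma hdotZr a x z : hdot z (a *: x) = Num.conj a * hdot z x.
Proof. exact: dotZr. Qed.

Lemma hdot_suml I (r : seq I) (F : I -> H) z :
  hdot (\sum_(i <- r) F i) z = \sum_(i <- r) hdot (F i) z.
Proof. exact: linear_sumlz. Qed.

Lemma hdot_sumr I (r : seq I) (F : I -> H) z :
  hdot z (\sum_(i <- r) F i) = \sum_(i <- r) hdot z (F i).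
Proof. exact: linear_sumr. Qed.

Lemma hdot_nrm x : hdot x x = (nrm x ^+ 2)%:C.
Proof. by rewrite hdot_norm nrmE rmorphXn. Qed.

Lemma hdot_inj x y : (forall z, hdot z x = hdot z y) -> x = y.
Proof.
move=> xy; apply/subr0_eq/nrm_eq0/eqP; rewrite -sqrf_eq0; apply/eqP/complexI.
by rewrite -hdot_nrm hdotBr xy subrr.
Qed.

Lemma nrm_hdot x y : nrm (hdot x y) <= nrm x * nrm y.
Proof.
rewrite -(@ler_pXn2r _ 2) ?nnegrE ?mulr_ge0 ?nrm_ge0//.
rewrite -lecR exprMn [X in _ <= X]rmorphM/= -!hdot_nrm rmorphXn/= -nrmE.
exact: cauchy_schwarz.
Qed.

Lemma nrm_sqD x y :
  nrm (x + y) ^+ 2 = nrm x ^+ 2 + nrm y ^+ 2 + complex.Re (hdot x y) *+ 2.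
Proof.
apply: complexI; rewrite 2!rmorphD/= -!hdot_nrm hdotDl !hdotDr (hdotC y x).
rewrite rmorphMn/= -[(_)%:C *+ 2]mulr_natl -addcJ.
ring.
Qed.

Lemma parallelogram x y :
  nrm (x + y) ^+ 2 + nrm (x - y) ^+ 2 = nrm x ^+ 2 *+ 2 + nrm y ^+ 2 *+ 2.
Proof.
rewrite !nrm_sqD nrmN -scaleN1r hdotZr rmorphN1 mulN1r raddfN/=; lra.
Qed.

Lemma cvg_hdotl z (u : nat -> H) l :
  u @ \oo --> l ->
  (fun n => hdot (u n) z : R[i]^o) @ \oo --> (hdot l z : R[i]^o).
Proof.
apply: (@cvg_lip _ _ R[i]^o (fun x => hdot x z) (nrm z)) => x y.
by rewrite -hdotBl mulrC nrm_hdot.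
Qed.

Lemma cvg_hdotr z (u : nat -> H) l :
  u @ \oo --> l ->
  (fun n => hdot z (u n) : R[i]^o) @ \oo --> (hdot z l : R[i]^o).
Proof.
apply: (@cvg_lip _ _ R[i]^o (fun x => hdot z x) (nrm z)) => x y.
by rewrite -hdotBr nrm_hdot.
Qed.

End Hdot.

(** * Riesz representation on a subspace *)

Section Riesz.
Variables (R : realType) (H : hilbertType R).

(* The vector [g] minimizes [|h|^2 - 2 Re a] over the relation [G]. *)
Lemma riesz_moment (G : H -> R[i] -> Prop) (M : R) :
  0 <= M -> G 0 0 ->
  (forall h a k b, G h a -> G k b -> G (h + k) (a + b)) ->
  (forall c h a, G h a -> G (c *: h) (c * a)) ->
  (forall h a, G h a -> nrm a <= M * nrm h) ->
  exists2 g : H, nrm g <= M & forall h a, G h a -> hdot h g = a.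
Proof.
move=> M0 G0 GD GZ GM.
pose q (h : H) (a : R[i]) : R := nrm h ^+ 2 - complex.Re a *+ 2.
pose E : set R := [set r | exists h a, G h a /\ r = q h a].
have Elb : lbound E (- M ^+ 2).
  move=> _ [h [a [Gha ->]]]; rewrite /q.
  have := GM _ _ Gha; have := nrm_Re a; have := sqr_ge0 (nrm h - M); nra.
have hE : has_inf E by split; [exists (q 0 0), 0, 0 | exists (- M ^+ 2)].
pose J := inf E.
pose e n : R := n.+1%:R^-1.
have Jle h a : G h a -> J <= q h a.
  by move=> Gha; apply: ge_inf; [exists (- M ^+ 2)|exists h, a].
have /choice[w wP] n : exists w : H * R[i],
    G w.1 w.2 /\ q w.1 w.2 < J + e n.
  have [|r [h [a [Gha ->]]] qJ] := @inf_adherent _ E (e n) _ hE.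
    by rewrite invr_gt0.
  by exists (h, a).
pose h n := (w n).1; pose a n := (w n).2.
(* The midpoint of [h n] and [h m] is in the domain, so [q] is at least [J] there; the parallelogram
   law turns this into a bound on their distance. *)
have close n m : nrm (h n - h m) ^+ 2 <= (e n + e m) *+ 2.
  have [Gn qn] := wP n; have [Gm qm] := wP m.
  have := Jle _ _ (GZ (2^-1)%:C _ _ (GD _ _ _ _ Gn Gm)).
  have := parallelogram (h n) (h m).
  rewrite /q /h nrmZ nrmR ger0_norm ?invr_ge0// exprMn.
  have -> : complex.Re ((2^-1)%:C * ((w n).2 + (w m).2)) =
      2^-1 * (complex.Re (w n).2 + complex.Re (w m).2).
    by case: (w n).2 => ? ?; case: (w m).2 => ? ?; rewrite /= mul0r subr0.
  by move: qn qm; rewrite /q /h /a; lra.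
have inv0 (r : R) : 0 < r -> exists N, forall n, (N <= n)%N -> e n < r.
  move=> r0; have /cvgrPdist_lt/(_ r r0)[N _ Ne] := @cvg_harmonic R.
  exists N => n Nn; have := Ne n Nn.
  by rewrite /= sub0r normrN ger0_norm // invr_ge0.
have [g hg] : exists g : H, h @ \oo --> g.
  apply: cauchy_nrm_cvg => r r0.
  have [|N Ne] := inv0 (r ^+ 2 / 4); first by rewrite divr_gt0// exprn_gt0.
  exists N => n Nn; rewrite -(@ltr_pXn2r _ 2) ?nnegrE ?nrm_ge0 ?ltW//.
  by have := close n N; have := Ne _ Nn; have := Ne _ (leqnn N); lra.
have gP k b : G k b -> hdot k g = b.
  move=> Gkb; pose c := nrm k ^+ 2 + 1.
  have c0 : 0 < c by rewrite /c ltr_wpDl ?sqr_ge0.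
  (* Moving [h n] by [t *: k] changes [q] by |t|^2 |k|^2 + 2 Re (t d), which is more than -[e n] by
     near-minimality. The choice of [t] makes this change at most -|d|^2 / c, because c > |k|^2. *)
  have dist n : nrm (hdot k (h n) - b) ^+ 2 <= c * e n.
    set d := _ - b; pose t := - (c^-1)%:C * Num.conj d.
    have [Gn qn] := wP n.
    have := Jle _ _ (GD _ _ _ _ Gn (GZ t _ _ Gkb)).
    move: qn; rewrite /q -/(h n) -/(a n) nrm_sqD nrmZ hdotC hdotZl.
    rewrite raddfD/=.
    have -> : complex.Re (Num.conj (t * hdot k (h n))) =
        complex.Re (t * b) - c^-1 * nrm d ^+ 2.
      have -> : complex.Re (Num.conj (t * hdot k (h n))) =
          complex.Re (t * hdot k (h n)).
        by case: (t * _).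
      have -> : hdot k (h n) = b + d by rewrite addrC subrK.
      have -> : t * (b + d) = t * b - (c^-1 * nrm d ^+ 2)%:C.
        by rewrite rmorphM/= nrm_sqr mulrDr /t; ring.
      by rewrite raddfB.
    have -> : nrm t = c^-1 * nrm d.
      by rewrite /t nrmM nrmN nrmR nrmJ ger0_norm// invr_ge0 ltW.
    rewrite exprMn.
    have kc : c^-1 * (nrm k ^+ 2 + 1) = 1 by rewrite mulVf// gt_eqF.
    move=> q1 q2.
    rewrite -ler_pdivrMl//.
    suff : c^-1 ^+ 2 * nrm d ^+ 2 * nrm k ^+ 2 <= c^-1 * nrm d ^+ 2.
      by move: q1 q2; rewrite exprMn; lra.
    have i0 : 0 <= c^-1 by rewrite invr_ge0 ltW.
    have iK : 0 <= 1 - c^-1 * nrm k ^+ 2 by rewrite -kc; lra.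
    have := mulr_ge0 (mulr_ge0 i0 (sqr_ge0 (nrm d))) iK; nra.
  have : (fun n => hdot k (h n) : R[i]^o) @ \oo --> (b : R[i]^o).
    apply/cvg_nrmP/cvgrPdist_lt => r r0.
    have [|N Ne] := inv0 (r ^+ 2 / c); first by rewrite divr_gt0// exprn_gt0.
    exists N => // n Nn; rewrite /= sub0r normrN ger0_norm ?nrm_ge0//.
    rewrite -(@ltr_pXn2r _ 2) ?nnegrE ?nrm_ge0 ?ltW//.
    apply: le_lt_trans (dist n) _.
    by rewrite -ltr_pdivlMl// mulrC; exact: Ne.
  exact: seq_cvg_unique (cvg_hdotr hg).
exists g => //.
(* The limit [g] may lie outside the domain of [G], so the bound is applied to [h n] and passed to
   the limit, giving |g|^2 <= M |g|. *)
have gn n : nrm (hdot (h n) g) <= M * nrm (h n).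
  by have [Gn _] := wP n; rewrite (gP _ _ Gn); exact: GM.
have : nrm (hdot g g) <= M * nrm g.
  apply: (@ler_cvg_to _ \oo _ _ (fun n => nrm (hdot (h n) g))
    (fun n => M * nrm (h n))).
  - exact: (cvg_nrm (cvg_hdotl hg)).
  - by apply: cvgMr; exact: cvg_nrm.
  - by near=> n; exact: gn.
rewrite hdot_nrm nrmR ger0_norm ?sqr_ge0// expr2.
have [|g0 _] := ltP 0 (nrm g); first by move=> g0; rewrite ler_pM2r.
exact: le_trans M0.
Unshelve. all: by end_near. Qed.

End Riesz.

(** * Bounded operators: adjoints, Neumann series, square roots *)

Section Operators.
Variable R : realType.

Definition mk_linear (X Y : hilbertType R) (f : X -> Y) (lf : linear f) :
  {linear X -> Y} := HB.pack f (GRing.isLinear.Build R[i] X Y *:%R f lf).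

Lemma mk_bounded_subproof (X Y : hilbertType R) (f : X -> Y) (lf : linear f)
    (M : R) (fM : forall x, nrm (f x) <= M * nrm x) :
  exists M : R[i], forall x, `|mk_linear lf x| <= M * `|x|.
Proof.
by exists M%:C => x; rewrite [`|x|]nrmE -rmorphM/= nrm_le fM.
Qed.

Definition mk_bounded (X Y : hilbertType R) (f : X -> Y) (lf : linear f)
    (M : R) (fM : forall x, nrm (f x) <= M * nrm x) : boundedOp X Y :=
  BoundedOp (mk_bounded_subproof lf fM).

(** On the zero space the constant in [boundedOpP] may be any complex number; its modulus works in
    every case. *)
Lemma bounded_nrm (X Y : hilbertType R) (T : boundedOp X Y) :
  exists2 M : R, 0 <= M & forall x, nrm (T x) <= M * nrm x.
Proof.
have [M TM] := boundedOpP T; exists (nrm M); first exact: nrm_ge0.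
move=> x; apply: le_trans (_ : nrm (M * `|x|) <= _).
  rewrite -lecR -!nrmE; apply: le_trans (TM x) _.
  by rewrite real_ler_norm// ger0_real// (le_trans _ (TM x)).
by rewrite nrmM {2}/nrm normr_id.
Qed.

Lemma adj_unique (X Y : hilbertType R) (T : X -> Y) (y : Y) (z : X) :
  (forall x, hdot (T x) y = hdot x z) -> adj T y = z.
Proof.
move=> Tz; apply: xget_unique => // w Tw.
by apply: hdot_inj => x; rewrite -Tw Tz.
Qed.

(** Riesz applied to x |-> <T x, y> shows that the vector sought by [xget] exists, so [adj] does not
    fall back on its default 0. *)
Lemma adjP (X Y : hilbertType R) (T : boundedOp X Y) (x : X) (y : Y) :
  hdot (T x) y = hdot x (adj T y).
Proof.
have [M M0 TM] := bounded_nrm T.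
have [|||||z _ Tz] := @riesz_moment R X (fun h a => a = hdot (T h) y)
  (M * nrm y).
- by rewrite mulr_ge0 ?nrm_ge0.
- by rewrite linear0 hdot0l.
- by move=> h a k b -> ->; rewrite linearD hdotDl.
- by move=> c h a ->; rewrite linearZ/= hdotZl.
- move=> h a ->; apply: le_trans (nrm_hdot _ _) _.
  by rewrite mulrAC ler_wpM2r ?nrm_ge0.
have Tz' w : hdot (T w) y = hdot w z by rewrite (Tz w _ erefl).
by rewrite (adj_unique Tz').
Qed.

Lemma adjPr (X Y : hilbertType R) (T : boundedOp X Y) (x : X) (y : Y) :
  hdot y (T x) = hdot (adj T y) x.
Proof. by rewrite hdotC adjP -hdotC. Qed.

Lemma adj_linear (X Y : hilbertType R) (T : boundedOp X Y) : linear (adj T).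
Proof.
move=> c y z; apply: hdot_inj => x.
by rewrite -adjP !(hdotDr, hdotZr) !adjP.
Qed.

(** |T^* y|^2 = <T T^* y, y> <= M |T^* y| |y|, from which one factor |T^* y| is cancelled. *)
Lemma nrm_adj (X Y : hilbertType R) (T : boundedOp X Y) (M : R) :
  0 <= M -> (forall x, nrm (T x) <= M * nrm x) ->
  forall y, nrm (adj T y) <= M * nrm y.
Proof.
move=> M0 TM y; apply: le_of_sqr_le; rewrite ?nrm_ge0//.
rewrite -[X in X <= _]ger0_norm ?sqr_ge0// -nrmR -hdot_nrm -adjP.
by apply: le_trans (nrm_hdot _ _) _; rewrite ler_wpM2r ?nrm_ge0.
Qed.

Lemma op_inv_eq (X : hilbertType R) (T : X -> X) (x y : X) :
  injective T -> T x = y -> op_inv T y = x.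
Proof.
by move=> Ti Tx; apply: xget_unique => // z Tz; apply: Ti; rewrite Tx.
Qed.

Lemma cvg_linear (X Y : hilbertType R) (T : {linear X -> Y}) (M : R)
    (u : nat -> X) l :
  (forall x, nrm (T x) <= M * nrm x) -> u @ \oo --> l -> (T \o u) @ \oo --> T l.
Proof.
by move=> TM; apply: (@cvg_lip _ _ _ _ M) => x y; rewrite -linearB.
Qed.

(** From |x| <= |x - T x| + c |x|. This gives both the injectivity of I - T and the bound on its
    inverse. *)
Lemma neumann_le (X : hilbertType R) (T : X -> X) (c : R) :
  c < 1 -> (forall x, nrm (T x) <= c * nrm x) ->
  forall x, nrm x <= (1 - c)^-1 * nrm (x - T x).
Proof.
move=> c1 Tc x; rewrite ler_pdivlMl ?subr_gt0//.
by have := nrm_tri (T x) x 0; rewrite !subr0; have := Tc x; lra.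
Qed.

(** The iterates of x |-> y + T x from 0 are the partial sums of the Neumann series; they are
    majorized by the geometric sums [s], and their limit is a fixed point. *)
Lemma neumann (X : hilbertType R) (T : {linear X -> X}) (c : R) :
  0 <= c -> c < 1 -> (forall x, nrm (T x) <= c * nrm x) ->
  forall y, exists x, x - T x = y.
Proof.
move=> c0 c1 Tc y; pose u := fix u n := if n is n'.+1 then y + T (u n') else 0.
have uS n : nrm (u n.+1 - u n) <= c ^+ n * nrm y.
  elim: n => [|n IH]; first by rewrite /= linear0 addr0 subr0 mul1r.
  have -> : u n.+2 - u n.+1 = T (u n.+1 - u n).
    by rewrite linearB/= opprD addrACA subrr add0r.
  by apply: le_trans (Tc _) _; rewrite exprS -mulrA ler_wpM2l.
pose s n := (1 - c ^+ n) / (1 - c) * nrm y.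
have c1' : 0 < 1 - c by rewrite subr_gt0.
have [x ux] : exists x : X, u @ \oo --> x.
  apply: (@telescope_cvg _ _ u s ((1 - c)^-1 * nrm y)) => n.
    apply: le_trans (uS n) _; rewrite /s -mulrBl -mulrBl exprS.
    have -> : 1 - c * c ^+ n - (1 - c ^+ n) = (1 - c) * c ^+ n by ring.
    by rewrite [_ / _]mulrAC mulfV ?mul1r// gt_eqF.
  rewrite ler_wpM2r ?nrm_ge0// ler_pdivrMr// mulVf ?gt_eqF//.
  by rewrite gerBl exprn_ge0.
exists x; apply/eqP; rewrite subr_eq; apply/eqP.
apply: (@seq_cvg_unique _ _ (fun n => u n.+1)); first by rewrite cvg_shiftS.
apply: cvgD; first exact: cvg_cst.
exact: cvg_linear Tc ux.
Qed.

(* [P_(n+1) = (M + P_n^2) / 2] converges to a solution of [2 P = M + P^2], that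
   is [(I - P)^2 = I - M]; its increments are dominated by those of the scalar
   iteration for [M = 1], which is increasing and bounded by 1. *)
Lemma sqrt_compl (K : hilbertType R) (M : boundedOp K K) :
  (forall x, nrm (M x) <= nrm x) ->
  (forall x y, hdot (M x) y = hdot x (M y)) ->
  exists Q : boundedOp K K,
    (forall x y, hdot (Q x) y = hdot x (Q y)) /\
    (forall x, Q (Q x) = x - M x).
Proof.
move=> M1 Msym.
have half : nrm (2^-1 : R[i]) = 2^-1.
  have -> : 2^-1 = (2^-1 : R)%:C :> R[i] by rewrite fmorphV rmorph_nat.
  by rewrite nrmR ger0_norm ?invr_ge0.
pose P := fix P n := if n is n'.+1 then
  fun x : K => 2^-1 *: (M x + P n' (P n' x)) else fun=> 0.
pose s := fix s n : R := if n is n'.+1 then 2^-1 * (1 + s n' ^+ 2) else 0.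
have s01 n : 0 <= s n <= 1.
  elim: n => [|n /andP[s0 s1]] /=; first by rewrite lexx ler01.
  by apply/andP; split; nra.
have PL n : linear (P n).
  elim: n => [|n IH] c x y /=; first by rewrite scaler0 addr0.
  rewrite linearP !IH addrACA -scalerDr [LHS]scalerDr !scalerA.
  by rewrite [2^-1 * c]mulrC.
have PB n x y : P n (x - y) = P n x - P n y := linearB (mk_linear (PL n)) x y.
have Ps n x : nrm (P n x) <= s n * nrm x.
  elim: n x => [|n IH] x /=; first by rewrite nrm0 mul0r.
  have /andP[s0 s1] := s01 n.
  rewrite nrmZ half; have := nrmD (M x) (P n (P n x)); have := M1 x.
  have := IH x; have := le_trans (IH (P n x)) (ler_wpM2l s0 (IH x)).
  by nra.
have P1 n x : nrm (P n x) <= nrm x.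
  apply: le_trans (Ps n x) _; rewrite ler_piMl ?nrm_ge0//.
  by case/andP: (s01 n).
have PS n x : nrm (P n.+1 x - P n x) <= (s n.+1 - s n) * nrm x.
  elim: n x => [|n IH] x.
    by rewrite /= !subr0 expr0n !addr0 mulr1 nrmZ half ler_wpM2l.
  (* P_(n+1)^2 - P_n^2 = P_(n+1) (P_(n+1) - P_n) + (P_(n+1) - P_n) P_n holds without commuting the
     factors, and [s] satisfies the same identity. *)
  have -> : P n.+2 x - P n.+1 x = 2^-1 *: (P n.+1 (P n.+1 x - P n x) +
      (P n.+1 (P n x) - P n (P n x))).
    rewrite PB addrA subrK [P n.+2]/= [in LHS]/=.
    by rewrite -scalerBr opprD addrACA subrr add0r.
  have /andP[s0 s1] := s01 n; have /andP[s0' s1'] := s01 n.+1.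
  rewrite nrmZ half.
  have h1 := le_trans (Ps n.+1 _) (ler_wpM2l s0' (IH x)).
  have d0 : 0 <= s n.+1 - s n by rewrite /=; have := sqr_ge0 (1 - s n); nra.
  have h2 := le_trans (IH (P n x)) (ler_wpM2l d0 (Ps n x)).
  apply: le_trans (ler_wpM2l _ (nrmD _ _)) _ => //.
  have -> : s n.+2 - s n.+1 = 2^-1 * (s n.+1 ^+ 2 - s n ^+ 2).
    by rewrite /=; ring.
  by nra.
have /choice[p pP] x : exists l : K, (fun n => P n x) @ \oo --> l.
  apply: (@telescope_cvg _ _ _ (fun n => s n * nrm x) (nrm x)) => n.
    by rewrite -mulrBl.
  by rewrite ler_piMl ?nrm_ge0//; case/andP: (s01 n).
have p1 x : nrm (p x) <= nrm x.
  apply: (@ler_cvg_to _ \oo _ _ _ _ _ _ (cvg_nrm (pP x)) (cvg_cst _)).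
  by near=> n.
have pL : linear p.
  move=> c x y; apply: (seq_cvg_unique (pP _)).
  rewrite (_ : (fun n => _) = (fun n => c *: P n x + P n y)).
    by apply: cvgD (pP y); apply: cvgZr.
  by apply/funext => n; rewrite PL.
have psym x y : hdot (p x) y = hdot x (p y).
  apply: (seq_cvg_unique (cvg_hdotl (pP x))).
  rewrite (_ : (fun n => _) = (fun n => hdot x (P n y))).
    exact: cvg_hdotr (pP y).
  apply/funext => n; elim: n x y => [|n IH] x y /=.
    by rewrite hdot0l hdotC hdot0l conjC0.
  rewrite hdotZl hdotZr hdotDl hdotDr !IH Msym.
  by congr (_ * _); rewrite geC0_conj// invr_ge0.
have pp x : p x = 2^-1 *: (M x + p (p x)).
  apply: (seq_cvg_unique (u := fun n => P n.+1 x)).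
    by rewrite (cvg_shiftS (fun n => P n x)).
  apply: cvgZr; apply: cvgD; first exact: cvg_cst.
  (* Convergence is only pointwise; since each [P n] is a contraction, comparing with [P n (p x)]
     still gives the limit of [P n (P n x)]. *)
  apply/cvg_nrmP.
  apply: (@squeeze_cvgr _ _ _ _ (cst 0)
    (fun n => nrm (P n x - p x) + nrm (P n (p x) - p (p x)))).
  - near=> n; rewrite nrm_ge0/=; apply: le_trans (nrm_tri (P n (p x)) _ _) _.
    by rewrite lerD2r -PB.
  - exact: cvg_cst.
  - by rewrite -(addr0 0); apply: cvgD; apply/cvg_nrmP.
have QL : linear (fun x => x - p x).
  by move=> c x y; rewrite pL scalerBr opprD addrACA.
have QM x : nrm (x - p x) <= 2 * nrm x.
  by have := nrmB x (p x); have := p1 x; lra.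
exists (mk_bounded QL QM); split=> [x y|x] /=.
  by rewrite hdotBl hdotBr psym.
have -> : p (x - p x) = p x - p (p x) := linearB (mk_linear pL) _ _.
have := pp x; move/(congr1 (fun z => 2 *: z)).
rewrite scalerA mulfV ?pnatr_eq0// scale1r scaler_nat mulr2n => e.
have -> : M x = p x + p x - p (p x) by rewrite e addrK.
by rewrite !opprB opprD -addrA [- p x + _]addrCA.
Unshelve. all: by end_near. Qed.

End Operators.

(** * The Hilbert direct sum of d copies of X and one of Y *)

Section DirectSum.
Variables (R : realType) (d : nat) (X Y : hilbertType R).

(* An alias, so as to get the l^2 norm and not the sup norm of the product. *)
Definition dsum : Type := ({ffun 'I_d -> X} * Y)%type.

HB.instance Definition _ :=
  GRing.Lmodule.copy dsum ({ffun 'I_d -> X} * Y)%type.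

Definition dsum_dot (k l : dsum) : R[i] :=
  \sum_(j < d) hdot (k.1 j) (l.1 j) + hdot k.2 l.2.

Lemma dsum_dot_hermitian (k l : dsum) :
  dsum_dot k l = (-1) ^+ false * Num.conj (dsum_dot l k).
Proof.
rewrite expr0 mul1r /dsum_dot rmorphD rmorph_sum/= [hdot k.2 _]hdotC.
by congr (_ + _); apply: eq_bigr => j _; rewrite hdotC.
Qed.

Lemma dsum_dotPl (l : dsum) : scalar (dsum_dot^~ l).
Proof.
move=> c k k'; rewrite /dsum_dot hdotDl hdotZl mulrDr mulr_sumr addrACA.
congr (_ + _); rewrite -big_split; apply: eq_bigr => j _.
by rewrite !ffunE hdotDl hdotZl.
Qed.

Lemma dsum_dotPr (l : dsum) : linear_for (Num.conj \; *%R) (dsum_dot l).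
Proof.
move=> c k k'; rewrite /dsum_dot hdotDr hdotZr/= mulrDr mulr_sumr addrACA.
congr (_ + _); rewrite -big_split; apply: eq_bigr => j _.
by rewrite !ffunE hdotDr hdotZr.
Qed.

Lemma dsum_dot_gt0 (k : dsum) : k != 0 -> 0 < dsum_dot k k.
Proof.
have s0 : 0 <= \sum_(j < d) hdot (k.1 j) (k.1 j).
  by apply: sumr_ge0 => j _; exact: dot_ge0.
rewrite lt_def addr_ge0 ?dot_ge0// andbT; apply: contraNN.
rewrite /dsum_dot paddr_eq0 ?dot_ge0// dnorm_eq0 => /andP[/eqP sk /eqP k2].
apply/eqP/(@injective_projections {ffun 'I_d -> X} Y k 0) => //.
apply/ffunP => j; rewrite !ffunE.
apply/eqP; rewrite -(@dnorm_eq0 _ _ hdot); apply/eqP.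
by apply: (psumr_eq0P _ sk) => // i _; exact: dot_ge0.
Qed.

HB.instance Definition _ := @bilinear_isBilinear.Build R[i] dsum dsum R[i]
  *%R (Num.conj \; *%R) dsum_dot (dsum_dotPl, dsum_dotPr).
HB.instance Definition _ := @isHermitianSesquilinear.Build R[i] dsum false
  Num.conj dsum_dot dsum_dot_hermitian.
HB.instance Definition _ := @isDotProduct.Build R[i] dsum dsum_dot dsum_dot_gt0.

HB.instance Definition _ := @Lmodule_isNormed.Build R[i] dsum
  (fun k => sqrtC (dsum_dot k k))
  (@dot_sqrtD R dsum dsum_dot) (@dot_sqrtZ R dsum dsum_dot)
  (@dot_sqrt0_eq0 R dsum dsum_dot).

Lemma dsum_dot_norm (k : dsum) : dsum_dot k k = `|k| ^+ 2.
Proof. by rewrite /Num.norm/= sqrtCK. Qed.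

Lemma nrm_dsum (k : dsum) :
  nrm k ^+ 2 = \sum_(j < d) nrm (k.1 j) ^+ 2 + nrm k.2 ^+ 2.
Proof.
apply: complexI; rewrite rmorphXn/= -nrmE -dsum_dot_norm rmorphD rmorph_sum/=.
by rewrite -hdot_nrm; congr (_ + _); apply: eq_bigr => j _; rewrite -hdot_nrm.
Qed.

Lemma nrm_dsum1 (k : dsum) j : nrm (k.1 j) <= nrm k.
Proof.
rewrite -(@ler_pXn2r _ 2) ?nnegrE ?nrm_ge0// nrm_dsum (bigD1 j)//= -addrA.
by rewrite lerDl addr_ge0 ?sqr_ge0 ?sumr_ge0// => i _; exact: sqr_ge0.
Qed.

Lemma nrm_dsum2 (k : dsum) : nrm k.2 <= nrm k.
Proof.
rewrite -(@ler_pXn2r _ 2) ?nnegrE ?nrm_ge0// nrm_dsum.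
by rewrite lerDr sumr_ge0// => i _; exact: sqr_ge0.
Qed.

Lemma nrm_dsum_le (k : dsum) (r : R) :
  (forall j, nrm (k.1 j) <= r) -> nrm k.2 <= r -> nrm k <= d.+1%:R * r.
Proof.
move=> k1 k2; have r0 : 0 <= r := le_trans (nrm_ge0 _) k2.
rewrite -(@ler_pXn2r _ 2) ?nnegrE ?mulr_ge0 ?nrm_ge0// nrm_dsum.
apply: le_trans (_ : d.+1%:R * r ^+ 2 <= _).
  rewrite -natr1 mulrDl mul1r lerD ?lerXn2r ?nnegrE ?nrm_ge0//.
  apply: le_trans (_ : \sum_(j < d) r ^+ 2 <= _).
    by apply: ler_sum => j _; rewrite lerXn2r ?nnegrE ?nrm_ge0.
  by rewrite sumr_const card_ord mulr_natl.
by rewrite exprMn ler_wpM2r ?sqr_ge0// expr2 ler_peMl// ler1n.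
Qed.

(** Coordinates are 1-Lipschitz, so they send [F] to Cauchy filters; there are finitely many, so
    their limits are approached simultaneously. *)
Lemma dsum_complete (F : set_system dsum) : ProperFilter F -> cauchy F -> cvg F.
Proof.
move=> FF /cauchyP Fc.
have proj (Z : hilbertType R) (p : dsum -> Z) :
    (forall k l, nrm (p k - p l) <= nrm (k - l)) -> exists z : Z, p @ F --> z.
  move=> pl; apply/cvg_ex; apply: cauchy_cvg; apply: cauchy_exP => e e0.
  have [k Fk] := Fc e e0; exists (p k).
  change (F (p @^-1` ball (p k) e)).
  apply: filterS Fk => l; rewrite /preimage/=.
  rewrite -!ball_normE /ball_/= => kl.
  have : `|p k - p l| <= `|k - l| by rewrite [leRHS]nrmE nrm_le.
  by move/le_lt_trans; apply.
have [|y Fy] := proj Y (fun k => k.2).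
  by move=> k l; exact: (nrm_dsum2 (k - l)).
have /choice[x Fx] (j : 'I_d) : exists x : X, (fun k : dsum => k.1 j) @ F --> x.
  apply: proj => k l; have := nrm_dsum1 (k - l) j.
  by rewrite !ffunE.
apply/cvg_ex; exists ([ffun j => x j], y); apply/cvg_ballP => e e0.
have eE : e = (complex.Re e)%:C by rewrite RRe_real// gtr0_real.
have e0' : 0 < complex.Re e by rewrite -ltcR -eE.
(* [nrm_dsum_le] costs a factor d + 1; dividing by d + 2 makes the final inequality strict. *)
pose r := complex.Re e / d.+2%:R.
have r0 : 0 < r by rewrite divr_gt0.
have rC : 0 < r%:C by rewrite ltcR.
have Fy' : \forall k \near F, nrm (y - k.2) <= r.
  move/cvgrPdist_lt: Fy => /(_ _ rC); apply: filterS => k.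
  by rewrite nrm_lt => /ltW.
have Fx' : \forall k \near F, forall j, nrm (x j - (k : dsum).1 j) <= r.
  apply: filter_forall => j.
  move/cvgrPdist_lt: (Fx j) => /(_ _ rC); apply: filterS => k.
  by rewrite nrm_lt => /ltW.
near=> k; rewrite -ball_normE /ball_/= eE nrm_lt.
apply: le_lt_trans (nrm_dsum_le (r := r) _ _) _.
- by move=> j; rewrite !ffunE; move: j; near: k.
- by near: k.
rewrite /r mulrCA -[X in _ < X]mulr1 ltr_pM2l// ltr_pdivrMr//.
by rewrite mul1r ltr_nat.
Unshelve. all: by end_near. Qed.

HB.instance Definition _ := Uniform_isComplete.Build dsum dsum_complete.

HB.instance Definition _ :=
  CompleteNormedModule_isHilbert.Build R dsum dsum_dot_norm.

End DirectSum.

(** * Contractive multipliers from a factored kernel *)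

Section Multiplier.
Variable R : realType.

Lemma dense_eq0 (H : hilbertType R) (D : set H) (f : H -> R[i]) (B : R) :
  dense D -> (forall x y, nrm (f x - f y) <= B * nrm (x - y)) ->
  (forall x, D x -> f x = 0) -> forall x, f x = 0.
Proof.
move=> dD fB fD x; apply: nrm_eq0; apply/eqP; rewrite eq_le nrm_ge0 andbT.
rewrite leNgt; apply/negP => fx0.
pose r := nrm (f x) / (`|B| + 1).
have B0 : 0 < `|B| + 1 by rewrite ltr_wpDl.
have r0 : 0 < r%:C by rewrite ltcR divr_gt0.
have [||y [xy Dy]] := dD (ball x r%:C); first by exists x; exact: ballxx.
  exact: ball_open.
have := fB x y; rewrite (fD _ Dy) subr0; apply/negP; rewrite -ltNge.
move: xy; rewrite -ball_normE /ball_/= nrm_lt => xy.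
apply: (@le_lt_trans _ _ (`|B| * r)).
  apply: le_trans (_ : `|B| * nrm (x - y) <= _).
    by rewrite ler_wpM2r ?nrm_ge0// ler_norm.
  by rewrite ler_wpM2l// ltW.
rewrite /r mulrA ltr_pdivrMr// mulrC ltr_pM2l// ltrDl//.
Qed.

(** Both sides are Lipschitz in [F] and agree on elementary tensors, whose span is dense. So the k_z
    (x) y act as kernel vectors of the Y-valued space. *)
Lemma tensor_reproducing (Omega : Type) (k : Omega -> Omega -> R[i])
    (H : rkhs k) (Y : hilbertType R) (HY : rkhs_tensor H Y) (F : HY) z y :
  hdot F (rt_tensor HY (rk_ker H z) y) = hdot (rt_eval HY z F) y.
Proof.
have [M M0 evM] := bounded_nrm (rt_eval HY z).
set t := rt_tensor _ _ _.
apply/eqP; rewrite -subr_eq0; apply/eqP.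
move: F.
apply: (dense_eq0 (B := nrm t + M * nrm y) (rt_tensor_dense (r := HY))).
  move=> F G; set ev := rt_eval HY z.
  have -> : hdot F t - hdot (ev F) y - (hdot G t - hdot (ev G) y) =
      hdot (F - G) t - hdot (ev (F - G)) y.
    by rewrite (linearB ev) !hdotBl; ring.
  apply: le_trans (nrmB _ _) _; rewrite mulrDl lerD//.
    by rewrite mulrC nrm_hdot.
  apply: le_trans (nrm_hdot _ _) _.
  by rewrite mulrAC ler_wpM2r ?nrm_ge0.
move=> _ [n [f [w ->]]]; rewrite linear_sum !hdot_suml -sumrB big1// => i _.
by rewrite rt_eval_tensor rt_tensor_dot rk_reproducing hdotZl subrr.
Qed.

Lemma nrm_sum_rt_tensor (Omega : Type) (k : Omega -> Omega -> R[i])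
    (H : rkhs k) (Y : hilbertType R) (HY : rkhs_tensor H Y) (I : Type)
    (s : seq I) (z : I -> Omega) (y : I -> Y) :
  (nrm (\sum_(i <- s) rt_tensor HY (rk_ker H (z i)) (y i)) ^+ 2)%:C =
  \sum_(i <- s) \sum_(j <- s) k (z j) (z i) * hdot (y i) (y j).
Proof.
rewrite -hdot_nrm hdot_suml; apply: eq_bigr => i _.
rewrite hdot_sumr; apply: eq_bigr => j _.
by rewrite rt_tensor_dot rk_reproducing rk_ker_eval.
Qed.

(* The factorization of [K_S] makes [k_z (x) y |-> k_z (x) S(z)^* y] a
   contraction, whose adjoint is [f |-> S f]. *)
Lemma factor_contractive_multiplier (d : nat) (U Y Z : hilbertType R)
    (S : uball R d -> boundedOp U Y) (W : uball R d -> Y -> Z) :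
  (forall l z y y', hdot (K_S S l z y) y' = hdot (W z y) (W l y')) ->
  contractive_multiplier S.
Proof.
move=> KW H HU HY f.
pose ev z := rt_eval HU z f.
(* The wanted functional h |-> <h, S f> on the span of the kernel vectors. Different lists may give
   the same [h]; the bound by |f| |h| forces them to give the same [a]. *)
pose G (h : HY) (a : R[i]) := exists s : seq (uball R d * Y),
  h = \sum_(p <- s) rt_tensor HY (rk_ker H p.1) p.2 /\
  a = \sum_(p <- s) hdot p.2 (S p.1 (ev p.1)).
have [|||||g gf Gg] := @riesz_moment R HY G (nrm f).
- exact: nrm_ge0.
- by exists [::]; rewrite !big_nil.
- by move=> h a k b [s [-> ->]] [t [-> ->]]; exists (s ++ t); rewrite !big_cat.
- move=> c h a [s [-> ->]]; exists [seq (p.1, c *: p.2) | p <- s].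
  rewrite !big_map scaler_sumr mulr_sumr; split; apply: eq_bigr => p _ /=.
    by rewrite linearZr_LR.
  by rewrite hdotZl.
- move=> h a [s [hE aE]].
  pose h' := \sum_(p <- s) rt_tensor HU (rk_ker H p.1) (adj (S p.1) p.2).
  have -> : a = hdot h' f.
    rewrite aE hdot_suml; apply: eq_bigr => p _.
    by rewrite adjPr [RHS]hdotC tensor_reproducing -hdotC.
  apply: le_trans (nrm_hdot _ _) _; rewrite mulrC ler_wpM2l ?nrm_ge0//.
  rewrite -(@ler_pXn2r _ 2) ?nnegrE ?nrm_ge0// -lecR -subr_ge0 hE.
  rewrite !nrm_sum_rt_tensor -sumrB.
  (* The difference |h|^2 - |h'|^2 is the sum over p, q of <K_S(q, p) p.2, q.2>, which the
     factorization turns into a squared norm. *)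
  suff -> : \sum_(p <- s) (\sum_(q <- s) k_DA q.1 p.1 * hdot p.2 q.2 -
      \sum_(q <- s) k_DA q.1 p.1 * hdot (adj (S p.1) p.2) (adj (S q.1) q.2)) =
      hdot (\sum_(p <- s) W p.1 p.2) (\sum_(p <- s) W p.1 p.2).
    exact: dot_ge0.
  rewrite hdot_suml; apply: eq_bigr => p _; rewrite hdot_sumr -sumrB.
  apply: eq_bigr => q _; rewrite -KW /K_S hdotZl hdotBl adjP.
  by rewrite mulrBr.
exists g; last by rewrite [`|f|]nrmE nrm_le.
move=> z; apply: hdot_inj => y.
rewrite hdotC -tensor_reproducing -hdotC; apply: Gg.
by exists [:: (z, y)]; rewrite !big_seq1.
Qed.

End Multiplier.

(** * The row operator of a point of C^d and its adjoint *)

Section Rows.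
Variables (R : realType) (d : nat) (X Y : hilbertType R).
Implicit Types (l z : 'rV[R[i]]_d) (k : dsum d X Y) (x : X) (y : Y).

Definition cn l : R := complex.Re (cnorm l).

Lemma cdot_self l : cdot l l = (\sum_(j < d) nrm (l 0 j) ^+ 2)%:C.
Proof. by rewrite rmorph_sum/=; apply: eq_bigr => j _; rewrite nrm_sqr. Qed.

Lemma cnormE l : cnorm l = (cn l)%:C.
Proof.
rewrite RRe_real// ger0_real// sqrtC_ge0 cdot_self lecR.
by rewrite sumr_ge0// => j _; exact: sqr_ge0.
Qed.

Lemma cn_ge0 l : 0 <= cn l.
Proof.
rewrite -lecR -cnormE sqrtC_ge0 cdot_self lecR.
by rewrite sumr_ge0// => j _; exact: sqr_ge0.
Qed.

Lemma cn_sqr l : cn l ^+ 2 = \sum_(j < d) nrm (l 0 j) ^+ 2.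
Proof. by apply: complexI; rewrite -cdot_self rmorphXn/= -cnormE sqrtCK. Qed.

(** Extended by 0 on the summand Y, so that composing it with V gives l_1 A_1 + ... + l_d A_d;
    [corow l] is its adjoint. *)
Definition comb l k : X := \sum_(j < d) l 0 j *: k.1 j.

Definition corow l x : dsum d X Y := ([ffun j => Num.conj (l 0 j) *: x], 0).

Lemma comb_linear l : linear (comb l).
Proof.
move=> c k k'; rewrite /comb scaler_sumr -big_split; apply: eq_bigr => j _.
by rewrite /= !ffunE scalerDr !scalerA mulrC.
Qed.

Lemma combBl l z k : comb (l - z) k = comb l k - comb z k.
Proof. by rewrite -sumrB; apply: eq_bigr => j _; rewrite !mxE scalerBl. Qed.

Lemma combDr l k k' : comb l (k + k') = comb l k + comb l k'.
Proof. exact: (linearD (mk_linear (comb_linear l))). Qed.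

Lemma hdot_dsum k k' :
  hdot k k' = \sum_(j < d) hdot (k.1 j) (k'.1 j) + hdot k.2 k'.2.
Proof. by []. Qed.

Lemma hdot_comb l k x : hdot (comb l k) x = hdot k (corow l x).
Proof.
rewrite hdot_dsum [hdot k.2 _](linear0r hdot) addr0 hdot_suml.
by apply: eq_bigr => j _; rewrite ffunE hdotZl hdotZr conjCK.
Qed.

Lemma nrm_corow l x : nrm (corow l x) = cn l * nrm x.
Proof.
apply/eqP; rewrite -(@eqrXn2 _ 2) ?mulr_ge0 ?nrm_ge0 ?cn_ge0//.
rewrite nrm_dsum nrm0 expr0n addr0 exprMn cn_sqr mulr_suml; apply/eqP.
by apply: eq_bigr => j _; rewrite ffunE nrmZ nrmJ exprMn.
Qed.

(** Cauchy-Schwarz against [corow l (comb l k)], whose norm is known exactly from [nrm_corow]. *)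
Lemma nrm_comb l k : nrm (comb l k) <= cn l * nrm k.
Proof.
apply: le_of_sqr_le; rewrite ?nrm_ge0 ?cn_ge0//.
rewrite -[leLHS]ger0_norm ?sqr_ge0// -nrmR -hdot_nrm hdot_comb.
by apply: le_trans (nrm_hdot _ _) _; rewrite nrm_corow mulrC.
Qed.

Lemma comb_corow l z x : comb l (corow z x) = cdot l z *: x.
Proof.
by rewrite /comb scaler_suml; apply: eq_bigr => j _; rewrite ffunE scalerA.
Qed.

End Rows.

(** * The column contraction V, its defect and the resolvent *)

Section Realization.
Variables (R : realType) (d : nat) (X Y : hilbertType R).
Variables (C : boundedOp X Y) (A : 'I_d -> boundedOp X X).
Hypothesis CA : contractive_pair C A.
Local Notation K := (dsum d X Y).

Definition col_fun (x : X) : K := ([ffun j => A j x], C x).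

Lemma col_linear : linear col_fun.
Proof.
move=> c x x'; apply: (@injective_projections {ffun 'I_d -> X} Y).
  by apply/ffunP => j; rewrite !ffunE linearP.
exact: linearP.
Qed.

(** Contractivity of the pair is the inequality V^* V <= I. The factor 1 is the shape [mk_bounded]
    expects. *)
Lemma nrm_col x : nrm (col_fun x) <= 1 * nrm x.
Proof.
rewrite mul1r -(@ler_pXn2r _ 2) ?nnegrE ?nrm_ge0// -lecR -subr_ge0.
rewrite -!hdot_nrm hdot_dsum.
have := CA x; rewrite hdotBl hdotDl hdot_suml -adjPr.
under eq_bigr do rewrite -adjPr.
by under [X in _ -> _ <= _ - (X + _)]eq_bigr do rewrite ffunE.
Qed.

Definition col_op : boundedOp X K := mk_bounded col_linear nrm_col.

Lemma comb_col (l : 'rV[R[i]]_d) x :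
  comb l (col_op x) = \sum_(j < d) l 0 j *: A j x.
Proof. by apply: eq_bigr => j _; rewrite ffunE. Qed.

Lemma defect_sqrt : exists Q : boundedOp K K,
  (forall k k', hdot (Q k) k' = hdot k (Q k')) /\
  (forall k, Q (Q k) = k - col_op (adj col_op k)).
Proof.
have ML : linear (fun k => col_op (adj col_op k)).
  by move=> c k k'; rewrite adj_linear linearP.
have M1 k : nrm (col_op (adj col_op k)) <= nrm k.
  apply: le_trans (nrm_col _) _; rewrite mul1r -[leRHS]mul1r.
  by apply: nrm_adj => //; exact: nrm_col.
have Msym k k' :
    hdot (col_op (adj col_op k)) k' = hdot k (col_op (adj col_op k')).
  by rewrite adjP adjPr.
have M1' k : nrm (col_op (adj col_op k)) <= 1 * nrm k by rewrite mul1r.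
exact: (@sqrt_compl _ _ (mk_bounded ML M1') M1 Msym).
Qed.

(** The row has norm at most |l| < 1 and V at most 1, so the Neumann series inverts I - l A;
    injectivity makes the chosen preimages depend linearly on the argument. *)
Lemma resolvent : exists Rs : uball R d -> boundedOp X X,
  (forall (l : uball R d) x, Rs l (x - comb l (col_op x)) = x) /\
  (forall (l : uball R d) x, Rs l x - comb l (col_op (Rs l x)) = x).
Proof.
suff /choice[Rs RsP] (l : uball R d) : exists T : boundedOp X X,
    (forall x, T (x - comb l (col_op x)) = x) /\
    (forall x, T x - comb l (col_op (T x)) = x).
  by exists Rs; split=> l; case: (RsP l).
pose c := cn l.
have c1 : c < 1 by rewrite -ltcR -cnormE; exact: uball_lt1.
have TL : linear (fun x => comb l (col_op x)).
  by move=> a x x'; rewrite linearP comb_linear.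
have Tc x : nrm (comb l (col_op x)) <= c * nrm x.
  apply: le_trans (nrm_comb _ _) _; rewrite ler_wpM2l ?cn_ge0//.
  by rewrite -[leRHS]mul1r nrm_col.
have /choice[T TP] := neumann (T := mk_linear TL) (cn_ge0 l) c1 Tc.
have GL : linear (fun x => x - comb l (col_op x)).
  by move=> a x x'; rewrite TL scalerBr opprD addrACA.
have inj : injective (fun x => x - comb l (col_op x)).
  move=> x x' /= e; apply/subr0_eq/nrm_eq0/eqP; rewrite eq_le nrm_ge0 andbT.
  apply: le_trans (neumann_le c1 Tc _) _.
  have -> : x - x' - comb l (col_op (x - x')) = 0.
    by apply: etrans (linearB (mk_linear GL) x x') _; rewrite /= e subrr.
  by rewrite nrm0 mulr0.
have TL' : linear T by move=> a x x'; apply: inj; rewrite GL !TP.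
have TM x : nrm (T x) <= (1 - c)^-1 * nrm x.
  by have := neumann_le c1 Tc (T x); rewrite [_ - _ as X in nrm X]TP.
by exists (mk_bounded TL' TM); split=> [x|x] /=; [apply: inj|]; rewrite TP.
Qed.

End Realization.

(** * Closure properties of bounded linear maps *)

Section BoundedMap.
Variable R : realType.

(** A property of plain functions: composite formulas are shown bounded piece by piece and packed
    into a [boundedOp] once, under [choice]. *)
Definition bounded_map (X Y : hilbertType R) (f : X -> Y) : Prop :=
  linear f /\ exists2 M : R, 0 <= M & forall x, nrm (f x) <= M * nrm x.

Lemma bounded_map_op (X Y : hilbertType R) (T : boundedOp X Y) : bounded_map T.
Proof. by split; [exact: linearP|exact: bounded_nrm]. Qed.

Lemma bounded_mapP (X Y : hilbertType R) (f : X -> Y) :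
  bounded_map f -> exists T : boundedOp X Y, forall x, T x = f x.
Proof. by move=> [lf [M _ fM]]; exists (mk_bounded lf fM). Qed.

Lemma bounded_map_comp (X Y Z : hilbertType R) (f : Y -> Z) (g : X -> Y) :
  bounded_map f -> bounded_map g -> bounded_map (fun x => f (g x)).
Proof.
move=> [lf [M M0 fM]] [lg [N N0 gN]]; split=> [c x y|].
  by rewrite lg lf.
exists (M * N) => [|x]; first exact: mulr_ge0.
by apply: le_trans (fM _) _; rewrite -mulrA ler_wpM2l.
Qed.

Lemma bounded_map_add (X Y : hilbertType R) (f g : X -> Y) :
  bounded_map f -> bounded_map g -> bounded_map (fun x => f x + g x).
Proof.
move=> [lf [M M0 fM]] [lg [N N0 gN]]; split=> [c x y|].
  by rewrite lg lf scalerDr addrACA.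
exists (M + N) => [|x]; first exact: addr_ge0.
by apply: le_trans (nrmD _ _) _; rewrite mulrDl lerD.
Qed.

Variables (d : nat) (X Y : hilbertType R).

Lemma bounded_map_comb (l : 'rV[R[i]]_d) :
  bounded_map (fun k : dsum d X Y => comb l k).
Proof.
by split; [exact: comb_linear|exists (cn l); [exact: cn_ge0|exact: nrm_comb]].
Qed.

Lemma bounded_map_fst j : bounded_map (fun k : dsum d X Y => k.1 j).
Proof.
split=> [c k k'|]; first by rewrite !ffunE.
by exists 1 => // k; rewrite mul1r nrm_dsum1.
Qed.

Lemma bounded_map_snd : bounded_map (fun k : dsum d X Y => k.2).
Proof. by split=> //; exists 1 => // k; rewrite mul1r nrm_dsum2. Qed.

End BoundedMap.

(** * The transfer function: kernel identity, multiplier property, analyticity *)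

Section Transfer.
Variables (R : realType) (d : nat) (X Y : hilbertType R).
Variables (C : boundedOp X Y) (A : 'I_d -> boundedOp X X).
Hypothesis CA : contractive_pair C A.
Local Notation K := (dsum d X Y).
Local Notation V := (col_op CA).
Variables (Q : boundedOp K K) (Rs : uball R d -> boundedOp X X).
Hypothesis Qsym : forall k k', hdot (Q k) k' = hdot k (Q k').
Hypothesis QQ : forall k, Q (Q k) = k - V (adj V k).
Hypothesis RsK : forall (l : uball R d) x, Rs l (x - comb l (V x)) = x.
Hypothesis KRs : forall (l : uball R d) x, Rs l x - comb l (V (Rs l x)) = x.

(** The operator G(l) of the overview; [obs_adj] is its adjoint. *)
Definition obs (l : uball R d) (k : K) : Y := k.2 + C (Rs l (comb l k)).

Lemma bounded_map_obs l : bounded_map (obs l).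
Proof.
apply: bounded_map_add; first exact: bounded_map_snd.
apply: bounded_map_comp (bounded_map_op C) _.
exact: bounded_map_comp (bounded_map_op _) (bounded_map_comb _ _ _).
Qed.

(** Split x = (x - l A x) + l A x under the resolvent: the first part contributes C x. *)
Lemma obs_col l x : obs l (V x) = C (Rs l x).
Proof.
rewrite -{2}(subrK (comb l (V x)) x) linearD RsK linearD.
by [].
Qed.

Definition obs_adj (z : uball R d) (y : Y) : K :=
  corow Y z (adj (Rs z) (adj C y)) + (0, y).

Lemma hdot_obs z k y : hdot (obs z k) y = hdot k (obs_adj z y).
Proof.
rewrite hdotDr -hdot_comb -!adjP hdotDl addrC hdot_dsum; congr (_ + _).
by rewrite big1 ?add0r// => j _; rewrite ffunE hdotC hdot0l conjC0.
Qed.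

Variable S : uball R d -> boundedOp K Y.
Hypothesis SE : forall l u, S l u = obs l (Q u).

Lemma adj_S z y : adj (S z) y = Q (obs_adj z y).
Proof. by apply: adj_unique => u; rewrite SE hdot_obs Qsym. Qed.

Lemma transfer_K_S (l z : uball R d) y :
  K_S S l z y = C (Rs l (adj (Rs z) (adj C y))).
Proof.
set w := adj (Rs z) _.
have wE : adj V (obs_adj z y) = w.
  apply: hdot_inj => x; rewrite -adjP -hdot_obs obs_col.
  by rewrite adjP adjP.
have oB k k' : obs l (k - k') = obs l k - obs l k'.
  exact: (linearB (mk_linear (bounded_map_obs l).1)).
rewrite /K_S adj_S SE QQ wE oB obs_col.
have -> : obs l (obs_adj z y) = y + cdot l z *: C (Rs l w).
  rewrite /obs /obs_adj combDr comb_corow -/w.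
  have -> : comb l ((0, y) : K) = 0.
    by rewrite /comb big1// => j _; rewrite ffunE scaler0.
  by rewrite /= add0r addr0 !linearZ.
have -> : y - (y + cdot l z *: C (Rs l w) - C (Rs l w)) =
    (1 - cdot l z) *: C (Rs l w).
  by rewrite opprB addrCA opprD addNKr scalerBl scale1r.
have [c1|c1] := eqVneq (1 - cdot l z) 0; last first.
  by rewrite scalerA mulVf// scale1r.
(* If <l, z> = 1, then w = <l, z> w has norm at most |l| |z| |w|. *)
suff -> : w = 0 by rewrite !linear0.
have lt1 (x : uball R d) : cn x < 1 by rewrite -ltcR -cnormE uball_lt1.
have := nrm_comb (l : 'rV_d) (corow Y z w).
rewrite comb_corow -(subr0_eq c1) scale1r nrm_corow => wle.
apply: nrm_eq0; apply/eqP; rewrite eq_le nrm_ge0 andbT leNgt.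
apply/negP => w0; move: wle; rewrite mulrA ler_pMl// leNgt.
by rewrite mulr_ilt1 ?cn_ge0.
Qed.

Lemma transfer_K_CA (l z : uball R d) y :
  K_CA C A l z y = C (Rs l (adj (Rs z) (adj C y))).
Proof.
rewrite /K_CA; set w := adj (Rs z) _.
have Tadj x v :
    hdot x (v - \sum_(j < d) Num.conj (uball_pt z 0 j) *: adj (A j) v) =
    hdot (x - comb z (V x)) v.
  rewrite hdotBr hdotBl hdot_sumr comb_col hdot_suml; congr (_ - _).
  by apply: eq_bigr => j _; rewrite hdotZr hdotZl conjCK adjP.
pose T v := v - \sum_(j < d) Num.conj (uball_pt z 0 j) *: adj (A j) v.
have -> : op_inv T (adj C y) = w.
  (* I - z A is onto, so its adjoint is injective: each test vector x is written as (I - z A) (Rs z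
     x). *)
  apply: op_inv_eq => [v v' e|]; apply: hdot_inj => x.
    by rewrite -(KRs z x) -!Tadj -/(T v) e.
  by rewrite Tadj /w -[LHS]adjP RsK.
pose T' x := x - \sum_(j < d) uball_pt l 0 j *: A j x.
have -> : op_inv T' w = Rs l w.
  apply: op_inv_eq => [x x'|]; last by rewrite /T' -(comb_col CA) KRs.
  by rewrite /T' -!(comb_col CA) => e; rewrite -(RsK l x) e RsK.
by [].
Qed.

Lemma transfer_multiplier : contractive_multiplier S.
Proof.
apply: (factor_contractive_multiplier
  (W := fun z y => adj (Rs z) (adj C y))) => l z y y'.
by rewrite transfer_K_S -!adjP.
Qed.

(** Resolvent identity: I - a A = (I - z A) + (z - a) A, applied to [Rs z x]. *)
Lemma Rs_perturb (a z : uball R d) x :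
  Rs z x = Rs a (x + comb (uball_pt z - uball_pt a) (V (Rs z x))).
Proof.
rewrite combBl addrA -{2}(KRs z x) subrK.
by rewrite -[LHS](RsK a).
Qed.

(** An exact increment formula: apart from the factor z - a, only [Rs z] depends on z, so replacing
    it by [Rs a] yields the derivative. *)
Lemma transfer_diff (a z : uball R d) u :
  S z u - S a u =
  C (Rs z (comb (uball_pt z - uball_pt a) (V (Rs a (comb a (Q u))) + Q u))).
Proof.
rewrite !SE /obs opprD addrACA subrr add0r -linearB; congr (C _).
set k := Q u; set x := Rs a (comb a k).
have -> : comb (uball_pt z - uball_pt a) (V x + k) =
    comb z k - (x - comb z (V x)).
  have xE : x = comb a k + comb a (V x).
    by apply/eqP; rewrite -subr_eq; apply/eqP; exact: KRs.
  rewrite combDr !combBl [X in _ - (X - _)]xE [LHS]addrC opprB opprD -addrA.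
  by rewrite [- comb a k + _]addrCA.
by rewrite linearB RsK.
Qed.

(** The resolvent identity gives |Rs z x| <= M |x| + |Rs z x| / 2, and the last term is absorbed on
    the left. *)
Lemma nrm_Rs_near (a z : uball R d) (M : R) :
  (forall x, nrm (Rs a x) <= M * nrm x) ->
  M * cn (uball_pt z - uball_pt a) <= 2^-1 -> 0 <= M ->
  forall x, nrm (Rs z x) <= 2 * M * nrm x.
Proof.
move=> RM Mh M0 x; set h := uball_pt z - uball_pt a.
have h0 := cn_ge0 h.
have : nrm (Rs z x) <= M * (nrm x + cn h * nrm (Rs z x)).
  rewrite {1}(Rs_perturb a z x); apply: le_trans (RM _) _.
  rewrite ler_wpM2l//; apply: le_trans (nrmD _ _) _; rewrite lerD2l.
  apply: le_trans (nrm_comb _ _) _; rewrite ler_wpM2l//.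
  by rewrite -[leRHS]mul1r nrm_col.
have := ler_wpM2r (nrm_ge0 (Rs z x)) Mh; rewrite -/h; lra.
Qed.

Lemma transfer_analytic : analytic S.
Proof.
move=> a.
have [M M0 RM] := bounded_nrm (Rs a).
have [MC MC0 CM] := bounded_nrm C.
pose B u : K := V (Rs a (comb a (Q u))) + Q u.
have bB : bounded_map B.
  apply: bounded_map_add; last exact: bounded_map_op.
  apply: bounded_map_comp (bounded_map_op V) _.
  apply: bounded_map_comp (bounded_map_op _) _.
  exact: bounded_map_comp (bounded_map_comb _ _ _) (bounded_map_op _).
have [MB MB0 BM] := bB.2.
have /choice[D DE] j : exists T : boundedOp K Y,
    forall u, T u = C (Rs a ((B u).1 j)).
  apply: bounded_mapP; apply: bounded_map_comp (bounded_map_op C) _.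
  apply: bounded_map_comp (bounded_map_op _) _.
  exact: bounded_map_comp (bounded_map_fst _ _ j) bB.
exists D => e e0.
have eE : e = (complex.Re e)%:C by rewrite RRe_real// gtr0_real.
set er := complex.Re e in eE; have er0 : 0 < er by rewrite -ltcR -eE.
pose L := MC * M * (2 * M) * MB.
have L0 : 0 <= L by rewrite !mulr_ge0.
(* The first bound gives M |h| <= 1/2, as [nrm_Rs_near] requires, and the second L |h| <= e; the
   added 1 covers M = 0 and L = 0. *)
pose r := Num.min (2 * (M + 1))^-1 (er / (L + 1)).
have r0 : 0 < r by rewrite lt_min invr_gt0 divr_gt0 ?mulr_gt0 ?ltr_wpDl.
exists r%:C => [|z]; first by rewrite ltcR.
set h := _ - _; rewrite cnormE ltcR => hr u.
have h0 := cn_ge0 h.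
have hM : M * cn h <= 2^-1.
  have : cn h <= (2 * (M + 1))^-1 by rewrite (le_trans (ltW hr))// ge_min lexx.
  rewrite -[leRHS]mul1r ler_pdivlMr ?mulr_gt0 ?ltr_wpDl//; lra.
have hL : L * cn h <= er.
  have : cn h <= er / (L + 1) by rewrite (le_trans (ltW hr))// ge_min lexx orbT.
  rewrite ler_pdivlMr ?ltr_wpDl//; lra.
have -> : \sum_(j < d) (uball_pt z 0 j - uball_pt a 0 j) *: D j u =
    C (Rs a (comb h (B u))).
  rewrite /comb !linear_sum; apply: eq_bigr => j _.
  by rewrite DE !linearZ !mxE.
rewrite transfer_diff -/h -/(B u) -linearB; set v := comb h _.
(* A second use of the resolvent identity brings out another factor h, so the remainder is at most L
   |h|^2 |u|. *)
have -> : Rs z v - Rs a v = Rs a (comb h (V (Rs z v))).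
  by rewrite {1}(Rs_perturb a z v) linearD addrAC subrr add0r.
rewrite eE [`|u|]nrmE -!rmorphM/= nrm_le.
apply: le_trans (_ : MC * (M * (cn h * (2 * M * (cn h * (MB * nrm u))))) <= _).
  apply: le_trans (CM _) _; rewrite ler_wpM2l//.
  apply: le_trans (RM _) _; rewrite ler_wpM2l//.
  apply: le_trans (nrm_comb _ _) _; rewrite ler_wpM2l//.
  apply: le_trans (_ : nrm (Rs z v) <= _).
    by rewrite -[leRHS]mul1r nrm_col.
  apply: le_trans (nrm_Rs_near RM hM M0 _) _; rewrite ler_wpM2l ?mulr_ge0//.
  by apply: le_trans (nrm_comb _ _) _; rewrite ler_wpM2l.
have -> : MC * (M * (cn h * (2 * M * (cn h * (MB * nrm u))))) =
    L * cn h * (cn h * nrm u) by rewrite /L; ring.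
by rewrite -[leRHS]mulrA ler_wpM2r// mulr_ge0 ?nrm_ge0.
Qed.

End Transfer.

Theorem theorem2p2 (R : realType) (d : nat) (X Y : hilbertType R)
    (C : boundedOp X Y) (A : 'I_d -> boundedOp X X) :
  contractive_pair C A ->
  exists (U : hilbertType R) (S : uball R d -> boundedOp U Y),
    schur_class S /\ forall l z : uball R d, K_S S l z = K_CA C A l z.
Proof.
move=> CA.
have [Q [Qsym QQ]] := defect_sqrt CA.
have [Rs [RsK KRs]] := resolvent CA.
have /choice[S SE] (l : uball R d) : exists T : boundedOp (dsum d X Y) Y,
    forall u, T u = obs C Rs l (Q u).
  apply: bounded_mapP.
  exact: bounded_map_comp (bounded_map_obs _ _ _) (bounded_map_op Q).
exists (dsum d X Y), S; split.
  split; first exact: (transfer_analytic RsK KRs SE).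
  exact: (transfer_multiplier Qsym QQ RsK SE).
move=> l z; apply/funext => y.
by rewrite (transfer_K_S Qsym QQ RsK SE) (transfer_K_CA RsK KRs).
Qed.
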